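(* Let $n$ be a positive integer, let $m_1,\ldots,m_n$ be nonnegative integers, and let $\mathbf{C}$ be a subset of $[m_1]_0\times[m_2]_0\times\cdots\times[m_n]_0$ such that, for each $i\in[n]$, if $u_i>0$ for some $\mathbf{u}\in\mathbf{C}$, then $m_i=\max\{u_i:\mathbf{u}\in\mathbf{C}\}$. Then $\mathbf{C}$ is the set of circuits of an integer polymatroid on $E=[n]$ if and only if $\mathbf{C}$ satisfies: (C1) each vector in $\mathbf{C}$ has at least two positive entries; (C2) if $\mathbf{u},\mathbf{v}\in\mathbf{C}$ with $\mathbf{u}\ne\mathbf{v}$, then $\mathbf{u}\not<\mathbf{v}$ and $\mathbf{v}\not<\mathbf{u}$; (C3) if $\mathbf{u},\mathbf{v}\in\mathbf{C}$ with $\mathbf{u}\neq\mathbf{v}$ and $u_i,v_i>0$, then there is $\mathbf{z}\in\mathbf{C}$ with $\mathbf{z}<\mathbf{u}\vee\mathbf{v}$ and $z_i<\max(u_i,v_i)$; (C4) if $\mathbf{u}\in\mathbf{C}$, $i\in E$ with $0<u_i<m_i$, and $j\in E-\{i\}$ with $0<u_j$, then there is $\mathbf{v}\in\mathbf{C}$ with $v_i=u_i+1$, $v_h\le u_h$ for all $h\ne i$, and $v_j<u_j$. Moreover, when (C1)–(C4) hold, there is exactly one integer polymatroid $\rho$ on $[n]$ with $\rho(\{i\})=m_i$ for all $i\in[n]$ whose set of circuits is $\mathbf{C}$.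
   Context: An integer polymatroid on a finite set $E$ is a function $\rho:2^E\to\mathbb{N}$ with $\rho(\emptyset)=0$, monotone ($A\subseteq B\Rightarrow\rho(A)\le\rho(B)$) and submodular ($\rho(A\cup B)+\rho(A\cap B)\le\rho(A)+\rho(B)$). For $m\in\mathbb{N}$, $[m]_0=\{0,1,\ldots,m\}$; $[n]=\{1,\ldots,n\}$. For $\mathbf{u},\mathbf{v}\in\mathbb{N}^n$: $\mathbf{u}\le\mathbf{v}$ means $u_i\le v_i$ for all $i$; $\mathbf{u}<\mathbf{v}$ means $\mathbf{u}\le\mathbf{v}$ and $\mathbf{u}\ne\mathbf{v}$; $\mathbf{u}\vee\mathbf{v}$ is the componentwise maximum. For $X\subseteq[n]$, $|\mathbf{u}|_X=\sum_{i\in X}u_i$. For an integer polymatroid $\rho$ on $[n]$, a vector $\mathbf{u}\in\mathbb{N}^n$ is independent if $|\mathbf{u}|_X\le\rho(X)$ for all $X\subseteq[n]$; with $\mathbf{U}=[\rho(\{1\})]_0\times\cdots\times[\rho(\{n\})]_0$, a circuit of $\rho$ is a vector $\mathbf{u}\in\mathbf{U}$ that is not independent but every $\mathbf{w}<\mathbf{u}$ is independent. *)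

(* Defs.v *)
From mathcomp Require Import all_boot all_order.
From mathcomp Require Import boolp classical_sets.

Set Implicit Arguments.
Unset Strict Implicit.
Unset Printing Implicit Defensive.

(* [classical_sets] shadows the name [set0]; the empty finite set is
   [finset.set0], while [{set E}], [:&:] and [:|:] are those of [finset]. *)

(* Set functions are finite functions, so that equality of polymatroids is
   equality of all their values. *)
Record is_polymatroid (E : finType) (rho : {ffun {set E} -> nat}) : Prop :=
  IsPolymatroid {
    polymatroid0 : rho finset.set0 = 0;
    polymatroid_mono : forall A B : {set E}, A \subset B -> rho A <= rho B;
    polymatroid_submod : forall A B : {set E},
      rho (A :|: B) + rho (A :&: B) <= rho A + rho B }.

(* Vectors in N^n; the ground set [n] = {1, ..., n} is indexed by 'I_n. *)
Definition vec (n : nat) : Type := {ffun 'I_n -> nat}.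

Section Vectors.
Variable n : nat.
Implicit Types (u v w : vec n) (X : {set 'I_n}) (C : set (vec n)).

Definition vle u v : Prop := forall i : 'I_n, u i <= v i.

Definition vlt u v : Prop := vle u v /\ u <> v.

Definition vjoin u v : vec n := [ffun i => maxn (u i) (v i)].

Definition vsum u X : nat := \sum_(i in X) u i.

Definition box (m : 'I_n -> nat) : set (vec n) :=
  [set u : vec n | forall i : 'I_n, u i <= m i]%classic.

Definition independent (rho : {ffun {set 'I_n} -> nat}) u : Prop :=
  forall X, vsum u X <= rho X.

Definition circuits (rho : {ffun {set 'I_n} -> nat}) : set (vec n) :=
  [set u : vec n | [/\ box (fun i => rho [set i]%SET) u,
                       ~ independent rho u &
                       forall w, vlt w u -> independent rho w]]%classic.

Definition C1 C : Prop :=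
  forall u, C u -> 2 <= #|[set i : 'I_n | 0 < u i]%SET|.

Definition C2 C : Prop :=
  forall u v, C u -> C v -> u <> v -> ~ vlt u v /\ ~ vlt v u.

Definition C3 C : Prop :=
  forall u v (i : 'I_n), C u -> C v -> u <> v -> 0 < u i -> 0 < v i ->
  exists z, [/\ C z, vlt z (vjoin u v) & z i < maxn (u i) (v i)].

Definition C4 (m : 'I_n -> nat) C : Prop :=
  forall u (i j : 'I_n), C u -> 0 < u i -> u i < m i -> j <> i -> 0 < u j ->
  exists v, [/\ C v, v i = u i + 1,
                forall h : 'I_n, h <> i -> v h <= u h & v j < u j].

Definition circuit_axioms (m : 'I_n -> nat) C : Prop :=
  [/\ C1 C, C2 C, C3 C & C4 m C].

End Vectors.

Definition is_max (S : set nat) (k : nat) : Prop :=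
  S k /\ forall j : nat, S j -> j <= k.

(* Main.v *)
(** In the circuits-to-polymatroid direction, call a vector of the box
    circuit-free if no element of C lies below it.  By (C3), adding a unit
    vector to a circuit-free vector creates at most one circuit; together with
    (C4) this gives the augmentation property, hence
    rho(X) := max |w|_X over circuit-free w is a polymatroid.  By (C4) again,
    every u in C satisfies |u| > rho(supp u), so the circuits of rho are exactly C.
    Conversely a circuit u of rho satisfies |u| = rho(supp u) + 1, from which
    (C3) and (C4) follow by submodularity.  For uniqueness, circuits and
    singleton ranks determine the independent vectors, and rho(X) is the largest
    |w|_X over these, since unions of tight sets are tight. *)

Require Import Defs.
From mathcomp Require Import all_boot all_order.
From mathcomp Require Import boolp classical_sets.
From mathcomp Require Import zify.

Set Implicit Arguments.
Unset Strict Implicit.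
Unset Printing Implicit Defensive.

(** * Vectors in N^n: unit steps, supports, sums over sets *)

Section VectorArithmetic.
Variable n : nat.
Implicit Types (u v w : vec n) (X Y : {set 'I_n}) (i j h : 'I_n).

Definition vinc w i : vec n := [ffun h => w h + (h == i)].
(** Subtraction is truncated, so this is w - e_i only when [0 < w i]. *)
Definition vdec w i : vec n := [ffun h => w h - (h == i)].
Definition vsupp w : {set 'I_n} := [set i | 0 < w i]%SET.
Definition vsize w : nat := vsum w finset.setT.
Definition vrestr w X : vec n := [ffun h => if h \in X then w h else 0].

(* [ffunP] leaves the domain of its variables in a form that [lia] does not
   identify with ['I_n]. *)
Lemma vecP u v : (forall i, u i = v i) -> u = v.
Proof. by move=> uv; apply/ffunP. Qed.

Lemma vdecK u i : 0 < u i -> vinc (vdec u i) i = u.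
Proof. by move=> ui; apply: vecP => h; rewrite !ffunE; case: eqP => [->|]; lia. Qed.

Lemma vle_refl u : vle u u.
Proof. by move=> h. Qed.

Lemma vle_trans u v w : vle u v -> vle v w -> vle u w.
Proof. by move=> uv vw h; apply: leq_trans (uv h) (vw h). Qed.

Lemma vle_vinc w i : vle w (vinc w i).
Proof. by move=> h; rewrite ffunE leq_addr. Qed.

Lemma vlt_vdec u i : 0 < u i -> vlt (vdec u i) u.
Proof.
move=> ui; split=> [h|e]; first by rewrite ffunE leq_subr.
have : vdec u i i = u i by rewrite e.
by rewrite ffunE eqxx; lia.
Qed.

Lemma vlt_exists u v : vlt u v -> exists i, u i < v i.
Proof.
move=> [le ne]; apply: contrapT => /forallNP H; apply: ne; apply: vecP => i.
by have := le i; have := H i; lia.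
Qed.

Lemma vsum_le u v X : vle u v -> vsum u X <= vsum v X.
Proof. by move=> uv; apply: leq_sum. Qed.

Lemma vsum_lt_exists u v X : vsum u X < vsum v X -> exists2 i, i \in X & u i < v i.
Proof.
move=> lt; apply: contrapT => H; suff : vsum v X <= vsum u X by lia.
by apply: leq_sum => i iX; rewrite leqNgt; apply/negP=> ?; apply: H; exists i.
Qed.

Lemma vsum_vinc w i X : vsum (vinc w i) X = vsum w X + (i \in X).
Proof.
rewrite /vsum; under eq_bigr do rewrite ffunE.
rewrite big_split /=; congr (_ + _).
case: (boolP (i \in X)) => iX.
  rewrite (bigD1 i) //= eqxx big1 // => h /andP[_ /negbTE ->] //.
by rewrite big1 // => h hX; case: eqP hX iX => // -> ->.
Qed.

Lemma vsum_vdec u i X : 0 < u i -> vsum u X = vsum (vdec u i) X + (i \in X).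
Proof. by move=> ui; rewrite -vsum_vinc vdecK. Qed.

Lemma vsum_subset u X Y : X \subset Y -> vsum u X <= vsum u Y.
Proof.
move=> sub; rewrite /vsum [leqRHS](big_setID X) /= (finset.setIidPr sub).
exact: leq_addr.
Qed.

Lemma vsum_setUI u X Y :
  vsum u (X :|: Y) + vsum u (X :&: Y) = vsum u X + vsum u Y.
Proof.
have eU : vsum u (X :|: Y) = vsum u X + vsum u (Y :\: X).
  rewrite /vsum (big_setID X) /= finset.setUK.
  by rewrite finset.setDUl finset.setDv finset.set0U.
have eY : vsum u Y = vsum u (X :&: Y) + vsum u (Y :\: X).
  by rewrite /vsum (big_setID X) /= (finset.setIC Y).
by rewrite eU eY; lia.
Qed.

Lemma vsum_supp u X : vsupp u \subset X -> vsum u X = vsize u.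
Proof.
move=> /fintype.subsetP sub; rewrite /vsize /vsum [RHS](big_setID X) /= finset.setTI.
rewrite [X in _ = _ + X]big1 ?addn0 // => i; rewrite !inE andbT => iX.
by apply/eqP; rewrite -leqn0 leqNgt; apply: contra iX => ui; apply: sub; rewrite inE.
Qed.

Lemma vsize_lt u v : vlt u v -> vsize u < vsize v.
Proof.
move=> uv; have [i lt] := vlt_exists uv; have [le _] := uv.
have : vle (vinc u i) v.
  by move=> h; rewrite ffunE; have := le h; case: eqP => [->|]; lia.
by move/(vsum_le finset.setT); rewrite vsum_vinc inE /vsize; lia.
Qed.

Lemma vsum_vrestr w X : vsum (vrestr w X) X = vsum w X.
Proof. by apply: eq_bigr => i iX; rewrite ffunE iX. Qed.

Lemma vrestr_le w X : vle (vrestr w X) w.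
Proof. by move=> i; rewrite ffunE; case: ifP. Qed.

Lemma vsupp_vrestr w X : vsupp (vrestr w X) \subset X.
Proof. by apply/fintype.subsetP=> i; rewrite inE ffunE; case: ifP. Qed.

End VectorArithmetic.

(** * From a polymatroid to its circuits *)

Section CircuitsOfPolymatroid.
Variables (n : nat) (rho : {ffun {set 'I_n} -> nat}).
Hypothesis rho_poly : is_polymatroid rho.
Implicit Types (u v w : vec n) (X Y : {set 'I_n}) (i j h : 'I_n).

Lemma independent_le u v : vle u v -> independent rho v -> independent rho u.
Proof. by move=> uv iv X; apply: leq_trans (vsum_le X uv) (iv X). Qed.

(** Descent on [vsize w] through dependent vectors below [w], which stay in the box. *)
Lemma dependent_exists_circuit w :
    box (fun i => rho [set i]%SET) w -> ~ independent rho w ->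
  exists2 u, circuits rho u & vle u w.
Proof.
have [k] := ubnP (vsize w); elim: k w => // k IH w lt bw dw.
have [all_ind|] := pselect (forall v, vlt v w -> independent rho v).
  by exists w => //; split.
move=> /existsNP[v /not_implyP[vw dv]]; have [le _] := vw.
have [||u cu uv] := IH v _ _ dv.
- by have := vsize_lt vw; lia.
- by move=> i; apply: leq_trans (le i) (bw i).
- by exists u => //; apply: vle_trans le.
Qed.

Lemma independent_vsize u : independent rho u -> vsize u <= rho (vsupp u).
Proof. by move=> iu; rewrite -(vsum_supp (X := vsupp u)). Qed.

(** A set violated by [u] contains the support, since lowering an entry outside it would keep the
    violation. So the support is violated, and only by one, as lowering any positive entry repairs
    it. *)
Lemma circuit_vsize u : circuits rho u -> vsize u = (rho (vsupp u)).+1.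
Proof.
move=> [_ du mu]; have [X lt] : exists X, rho X < vsum u X.
  apply: contrapT => /forallNP H; apply: du => X; have := H X; lia.
have sub : vsupp u \subset X.
  apply/fintype.subsetP=> i; rewrite inE => ui; apply: contrapT => iX.
  have := mu _ (vlt_vdec ui) X; have := vsum_vdec X ui.
  by move/negP/negbTE: iX => ->; lia.
have lt' : rho (vsupp u) < vsize u.
  by rewrite -(vsum_supp sub); apply: leq_ltn_trans (polymatroid_mono rho_poly sub) lt.
have [i iu] : exists i, i \in vsupp u.
  apply: contrapT => /forallNP H; move: lt'.
  by rewrite /vsize /vsum big1 // => i _; have := H i; rewrite inE; lia.
have ui : 0 < u i by move: iu; rewrite inE.
have := mu _ (vlt_vdec ui) (vsupp u); have := vsum_vdec (vsupp u) ui.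
by rewrite iu vsum_supp //; lia.
Qed.

Lemma circuits_C1 : C1 (circuits rho).
Proof.
move=> u [bu du _]; rewrite ltnNge; apply/negP => /card_le1_eqP le1.
apply: du => X.
have [[i iX ui]|H] := pselect (exists2 i, i \in X & 0 < u i); last first.
  rewrite /vsum big1 // => i iX.
  by apply/eqP; rewrite -leqn0 leqNgt; apply/negP=> ui; apply: H; exists i.
have -> : vsum u X = u i.
  rewrite /vsum (bigD1 i) //= big1 ?addn0 // => h /andP[_ /eqP hi].
  apply/eqP; rewrite -leqn0 leqNgt; apply/negP=> uh; apply: hi.
  by apply: le1; rewrite inE.
by apply: leq_trans (bu i) (polymatroid_mono rho_poly _); rewrite finset.sub1set.
Qed.

Lemma circuits_C2 : C2 (circuits rho).
Proof.
by move=> u v [_ du mu] [_ dv mv] _; split=> [/mv|/mu].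
Qed.

(** A circuit below the join minus e_i is as required, so it suffices that this vector is dependent.
    If [u i] and [v i] differ, it dominates whichever of [u] and [v] is smaller at [i]. *)
Lemma circuits_C3 : C3 (circuits rho).
Proof.
move=> u v i cu cv uv ui vi.
have [bu du mu] := cu; have [bv dv mv] := cv.
pose w := vdec (vjoin u v) i.
have wi : 0 < vjoin u v i by rewrite ffunE; lia.
have bw : box (fun i => rho [set i]%SET) w.
  by move=> h; rewrite !ffunE; have := bu h; have := bv h; lia.
suff dw : ~ independent rho w.
  have [z cz zw] := dependent_exists_circuit bw dw.
  exists z; split => //; last by have := zw i; rewrite !ffunE eqxx; lia.
  split=> [|e]; first by apply: vle_trans zw (vlt_vdec wi).1.
  by have := zw i; rewrite e !ffunE eqxx; move: wi; rewrite ffunE; lia.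
have [lt|lt|e] := ltngtP (u i) (v i).
- move=> iw; apply: du; apply: independent_le iw => h.
  by rewrite !ffunE; case: eqP => [->|]; lia.
- move=> iw; apply: dv; apply: independent_le iw => h.
  by rewrite !ffunE; case: eqP => [->|]; lia.
(* Equal entries at [i]: the meet [x] is independent, so submodularity on the two supports gives the
   join size at least rank + 2, and removing e_i leaves an excess. *)
pose x : vec n := [ffun h => minn (u h) (v h)].
have ix : independent rho x.
  apply: mu; split=> [h|xu]; first by rewrite ffunE; lia.
  apply: du; apply: mv; split=> // h.
  have : x h = u h by rewrite xu.
  by rewrite ffunE; lia.
have sx : vsupp x = vsupp u :&: vsupp v.
  by apply/setP=> h; rewrite !inE ffunE leq_min.
have sj : vsupp (vjoin u v) = vsupp u :|: vsupp v.
  by apply/setP=> h; rewrite !inE ffunE leq_max.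
have szj : vsize (vjoin u v) + vsize x = vsize u + vsize v.
  rewrite /vsize /vsum -!big_split; apply: eq_bigr => h _ /=.
  by rewrite !ffunE; lia.
move=> iw; have := iw (vsupp (vjoin u v)).
have := vsum_vdec (vsupp (vjoin u v)) wi; rewrite inE wi vsum_supp //.
have := independent_vsize ix; rewrite sx sj.
have := polymatroid_submod rho_poly (vsupp u) (vsupp v).
by have := circuit_vsize cu; have := circuit_vsize cv; rewrite /w; lia.
Qed.

(** The vector u - e_j + e_i has the size of [u] on the support of [u], hence is dependent. A
    circuit below it must use the added unit, or it would lie below the independent u - e_j. *)
Lemma circuits_C4 : C4 (fun i => rho [set i]%SET) (circuits rho).
Proof.
move=> u i j cu ui lti ji uj; have [bu du mu] := cu.
have nij : (j == i) = false by apply/eqP.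
pose w := vinc (vdec u j) i.
have dw : ~ independent rho w.
  move=> /(_ (vsupp u)); rewrite vsum_vinc inE ui.
  have := vsum_vdec (vsupp u) uj; rewrite inE uj vsum_supp //.
  by have := circuit_vsize cu; lia.
have bw : box (fun i => rho [set i]%SET) w.
  by move=> h; rewrite !ffunE; have := bu h; case: (eqVneq h i) => [->|]; lia.
have [v cv vw] := dependent_exists_circuit bw dw.
exists v; split=> //.
- apply/eqP; rewrite eqn_leq; apply/andP; split.
    by have := vw i; rewrite !ffunE eqxx; lia.
  rewrite leqNgt; apply/negP=> lt; have [_ dv _] := cv; apply: dv.
  apply: independent_le (mu _ (vlt_vdec uj)) => h.
  have := vw h; rewrite !ffunE; case: (eqVneq h i) => [->|]; last by lia.
  by rewrite eq_sym nij; lia.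
- by move=> h /eqP/negbTE hi; have := vw h; rewrite !ffunE hi; lia.
- by have := vw j; rewrite !ffunE nij eqxx; lia.
Qed.

Lemma tight_setU w X Y : independent rho w ->
  vsum w X = rho X -> vsum w Y = rho Y -> vsum w (X :|: Y) = rho (X :|: Y).
Proof.
move=> iw tX tY; apply/eqP; rewrite eqn_leq iw /=.
have := polymatroid_submod rho_poly X Y; have := vsum_setUI w X Y.
by have := iw (X :&: Y); lia.
Qed.

(** Take [w] maximal among independent vectors supported in [X]. Each element of [X] lies in a tight
    set; the union [Y] of these is tight and contains [X], so [w] has size rho(Y), at least
    rho(X). *)
Lemma rank_attained X : exists2 w, independent rho w & vsum w X = rho X.
Proof.
have [w [iw sw mw]] : exists w, [/\ independent rho w, vsupp w \subset X &
    forall i, i \in X -> ~ independent rho (vinc w i)].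
  have : exists w, independent rho w /\ vsupp w \subset X.
    exists [ffun=> 0]; split; last by apply/fintype.subsetP=> i; rewrite inE ffunE.
    by move=> Y; rewrite /vsum big1 // => i _; rewrite ffunE.
  (* Increments terminate because an independent vector has size at most rho of the ground set. *)
  move=> [w]; have [k] := ubnP (rho finset.setT - vsize w).
  elim: k w => // k IH w lt [iw sw].
  have [mw|] := pselect (forall i, i \in X -> ~ independent rho (vinc w i)).
    by exists w.
  move=> /existsNP[i /not_implyP[iX /contrapT iwi]].
  apply: (IH (vinc w i)).
    have := iwi finset.setT; move: lt.
    by rewrite /vsize vsum_vinc inE; lia.
  split=> //; apply/fintype.subsetP=> h; rewrite inE ffunE.
  case: eqP => [->//|_]; rewrite addn0 => wh; apply: (fintype.subsetP sw).
  by rewrite inE.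
have tight i : i \in X -> exists Y, i \in Y /\ vsum w Y = rho Y.
  move=> /mw /existsNP[Y]; rewrite vsum_vinc; have := iw Y => le nle.
  exists Y; case: (i \in Y) nle => /=; lia.
have cover (s : seq 'I_n) : {subset s <= X} ->
    exists Y, {subset s <= Y} /\ vsum w Y = rho Y.
  elim: s => [|i s IH] sX.
    exists finset.set0; split=> //.
    by rewrite (polymatroid0 rho_poly) /vsum big_set0.
  have [Y [sY tY]] := IH (fun h hs => sX h (mem_behead (s := i :: s) hs)).
  have [Z [iZ tZ]] := tight i (sX i (mem_head _ _)).
  exists (Z :|: Y); split; last exact: tight_setU.
  by move=> h; rewrite !inE => /predU1P[->|/sY ->]; rewrite ?iZ ?orbT.
have [|Y [sY tY]] := cover (enum X); first by move=> h; rewrite mem_enum.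
have XY : X \subset Y by apply/fintype.subsetP=> h hX; apply: sY; rewrite mem_enum.
exists w => //; apply/eqP; rewrite eqn_leq iw /= (vsum_supp sw).
rewrite -(vsum_supp (fintype.subset_trans sw XY)) tY.
exact: (polymatroid_mono rho_poly).
Qed.

(** Only singleton ranks and circuits occur on the right, which is what uniqueness requires. *)
Lemma independentE w : independent rho w <->
  box (fun i => rho [set i]%SET) w /\ forall u, circuits rho u -> ~ vle u w.
Proof.
split=> [iw|[bw nc]].
  split=> [i|u [_ du _] uw]; last by apply: du; apply: independent_le iw.
  by have := iw [set i]%SET; rewrite /vsum big_set1.
by apply: contrapT => /(dependent_exists_circuit bw)[u /nc].
Qed.

End CircuitsOfPolymatroid.

(** * Uniqueness of the polymatroid *)

Lemma rank_le_of_independent n (rho rho' : {ffun {set 'I_n} -> nat}) :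
    is_polymatroid rho ->
    (forall w, independent rho w -> independent rho' w) ->
  forall X, rho X <= rho' X.
Proof. by move=> pr sub X; have [w /sub iw <-] := rank_attained pr X. Qed.

Lemma polymatroid_circuits_inj n (rho rho' : {ffun {set 'I_n} -> nat}) :
    is_polymatroid rho -> is_polymatroid rho' ->
    (forall i, rho [set i]%SET = rho' [set i]%SET) ->
    circuits rho = circuits rho' ->
  rho = rho'.
Proof.
move=> pr pr' e1 ec.
have E w : independent rho w <-> independent rho' w.
  rewrite !independentE ec; split=> -[bw ?]; split=> // i.
    by rewrite -e1.
  by rewrite e1.
apply/ffunP=> X; apply/eqP; rewrite eqn_leq.
by rewrite !rank_le_of_independent // => w /E.
Qed.

(** * From the circuit axioms to a polymatroid: circuit-free vectors and augmentation *)

Section PolymatroidOfCircuits.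
Variables (n : nat) (m : 'I_n -> nat) (C : set (vec n)).
Hypothesis C_box : (C `<=` box m)%classic.
Hypothesis C_axioms : circuit_axioms m C.
Implicit Types (u v w x y z : vec n) (X Y : {set 'I_n}) (i j h : 'I_n).

Definition circuit_free w : Prop := box m w /\ forall u, C u -> ~ vle u w.

Lemma circuit_free_le u v : vle u v -> circuit_free v -> circuit_free u.
Proof.
move=> uv [bv nv]; split=> [i|c cc cu]; first exact: leq_trans (uv i) (bv i).
by apply: (nv c cc); apply: vle_trans uv.
Qed.

(** By (C2): a member of [C] below [w] would lie strictly below [u]. *)
Lemma circuit_free_vlt u w : C u -> vlt w u -> circuit_free w.
Proof.
move=> Cu [wu ne]; split=> [i|c Cc cw]; first exact: leq_trans (wu i) (C_box Cu i).
have [cu|cu] := pselect (c = u).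
  apply: ne; apply: vecP => i; apply/eqP; rewrite eqn_leq wu /=.
  by rewrite -cu cw.
have [_ c2 _ _] := C_axioms; have [H _] := c2 _ _ Cc Cu cu.
by apply: H; split=> //; apply: vle_trans wu.
Qed.

Lemma circuit_free0 : circuit_free [ffun=> 0].
Proof.
split=> [i|u Cu u0]; first by rewrite ffunE.
have [c1 _ _ _] := C_axioms; have := c1 _ Cu.
rewrite eq_card0 // => i; rewrite !inE.
by have := u0 i; rewrite ffunE; case: (u i).
Qed.

Lemma circuit_at_vinc z i u : circuit_free z -> C u -> vle u (vinc z i) ->
  u i = (z i).+1.
Proof.
move=> [_ nz] Cu uz; apply/eqP; rewrite eqn_leq; apply/andP; split.
  by have := uz i; rewrite ffunE eqxx; lia.
rewrite ltnNge; apply/negP=> le; apply: (nz u Cu) => h.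
by have := uz h; rewrite ffunE; case: eqP => [->|]; lia.
Qed.

(** Both circuits equal z_i + 1 at [i]; eliminating there by (C3) would give a circuit below [z]. *)
Lemma circuit_vinc_uniq z i u v : circuit_free z -> C u -> C v ->
  vle u (vinc z i) -> vle v (vinc z i) -> u = v.
Proof.
move=> fz Cu Cv uz vz; apply: contrapT => ne.
have ui := circuit_at_vinc fz Cu uz; have vi := circuit_at_vinc fz Cv vz.
have [_ _ c3 _] := C_axioms.
have [||t [Ct [tuv _] ti]] := c3 u v i Cu Cv ne; [by rewrite ui|by rewrite vi|].
have [_ nz] := fz; apply: (nz t Ct) => h.
have := tuv h; have := uz h; have := vz h; rewrite !ffunE.
by case: eqP => [->|]; lia.
Qed.

(* As for matroids: among the circuit-free z <= x \/ y larger than x, take one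
   of least deficit below x.  The unique circuit of z + e_i, for an i at which
   z falls short of x, is then below x: (C4) caps its entries that exceed x. *)
Lemma circuit_free_augment x y : circuit_free x -> circuit_free y ->
  vsize x < vsize y -> exists2 i, x i < y i & circuit_free (vinc x i).
Proof.
move=> fx fy lt; apply: contrapT => noaug.
suff H z : circuit_free z -> vle z (vjoin x y) -> vsize x < vsize z -> False.
  by apply: (H y) => // h; rewrite ffunE; lia.
have [k] := ubnP (\sum_i (x i - z i)); elim: k z => // k IH z ltk fz zxy xz.
(* Without deficit [z] dominates [x], and any entry where it is larger augments [x]. *)
have [[e ze]|nodef] := pselect (exists e : 'I_n, z e < x e); last first.
  have [i _ xi] := vsum_lt_exists xz; apply: noaug; exists i.
    by have := zxy i; rewrite ffunE; lia.
  apply: circuit_free_le fz => h; rewrite ffunE.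
  have /forallNP/(_ h) := nodef; case: eqP => [->|]; lia.
(* Moving a unit from [f] to [e] keeps the size and lowers the deficit, so by induction the result
   is not circuit-free. *)
have exch f : x f < z f -> exists2 u, C u & vle u (vdec (vinc z e) f).
  move=> xf; apply: contrapT => nou.
  have fe : (e == f) = false by apply/eqP=> ef; move: ze xf; rewrite ef; lia.
  have zf : 0 < vinc z e f by rewrite ffunE; lia.
  apply: (IH (vdec (vinc z e) f)).
  - rewrite -ltnS; apply: leq_ltn_trans _ ltk.
    rewrite (bigD1 e) //= [ltnRHS](bigD1 e) //= -addSn leq_add //.
      by rewrite !ffunE eqxx fe; lia.
    by apply: leq_sum => h he; rewrite !ffunE (negbTE he); case: eqP => [->|]; lia.
  - split=> [h|u Cu uw]; last by apply: nou; exists u.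
    have [bz _] := fz; have [bx _] := fx; rewrite !ffunE.
    by have := bz h; have := bx h; case: (eqVneq h e) => [->|]; lia.
  - move=> h; have := zxy h; rewrite !ffunE.
    by case: (eqVneq h e) => [->|]; lia.
  - have := vsum_vdec finset.setT zf; rewrite vsum_vinc !inE.
    by move: xz; rewrite /vsize; lia.
have [f _ xf] := vsum_lt_exists xz.
have [u Cu uf] := exch f xf.
have uz : vle u (vinc z e).
  by apply: vle_trans uf _ => h; rewrite [vdec _ _ _]ffunE leq_subr.
have ue := circuit_at_vinc fz Cu uz.
have [bz nz] := fz; have [_ nx] := fx; apply: (nx u Cu) => h.
have [->|he] := eqVneq h e; first by lia.
have uzh : u h <= z h by have := uz h; rewrite ffunE (negbTE he) addn0.
have [le|xh] := leqP (z h) (x h); first by lia.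
rewrite leqNgt; apply/negP=> xuh.
(* By uniqueness the circuit found for [h] is again [u], so [u] is strictly below [z] at [h]. *)
have [u' Cu' u'h] := exch h xh.
have uu' : u = u'.
  apply: (circuit_vinc_uniq fz Cu Cu' uz).
  by apply: vle_trans u'h _ => g; rewrite [vdec _ _ _]ffunE leq_subr.
have uzh' : u h < z h.
  by have := u'h h; rewrite -uu' !ffunE eqxx (negbTE he); lia.
have [_ _ _ c4] := C_axioms.
(* Raising [u] at [h] and lowering it at [e], the only entry where it exceeds [z], yields a circuit
   below [z]. *)
have [||||v [Cv vh vle ve]] := c4 u h e Cu.
- by lia.
- by have := bz h; lia.
- by move=> eh; rewrite eh eqxx in he.
- by rewrite ue.
apply: (nz v Cv) => g.
have [->|gh] := eqVneq g h; first by rewrite vh addn1.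
have [->|ge] := eqVneq g e; first by lia.
by have := vle g (elimN eqP gh); have := uz g; rewrite ffunE (negbTE ge); lia.
Qed.

(** Repeated augmentation; each increment occurs where [y] is positive, hence inside [X]. *)
Lemma circuit_free_extend x y X : circuit_free x -> circuit_free y ->
    vsupp x \subset X -> vsupp y \subset X ->
  exists z, [/\ circuit_free z, vle x z, vsupp z \subset X & vsize y <= vsize z].
Proof.
have [k] := ubnP (vsize y - vsize x); elim: k x => // k IH x ltk fx fy sx sy.
have [le|lt] := leqP (vsize y) (vsize x); first by exists x; split=> //; apply: vle_refl.
have [i xy fxi] := circuit_free_augment fx fy lt.
have [||z [fz xz sz yz]] := IH (vinc x i) _ fxi fy _ sy.
- by move: ltk lt; rewrite /vsize vsum_vinc inE; lia.
- apply/fintype.subsetP=> h; rewrite inE ffunE; case: eqP => [-> _|_].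
    by apply: (fintype.subsetP sy); rewrite inE; lia.
  by rewrite addn0 => xh; apply: (fintype.subsetP sx); rewrite inE.
by exists z; split=> //; apply: vle_trans (vle_vinc x i) xz.
Qed.

(** * The rank function, characterised as the maximum of |w|_X over circuit-free w *)

Section Rank.
Variable rho : {ffun {set 'I_n} -> nat}.
Hypothesis rho_attained :
  forall X, exists2 w, circuit_free w & vsum w X = rho X.
Hypothesis rho_ub : forall w X, circuit_free w -> vsum w X <= rho X.

(** Extend [x] using a maximiser cut down to [X], so that sizes and sums over [X] agree. *)
Lemma rank_attained_above x X : circuit_free x -> vsupp x \subset X ->
  exists z, [/\ circuit_free z, vle x z, vsupp z \subset X & vsum z X = rho X].
Proof.
move=> fx sx; have [y fy yX] := rho_attained X.
have fy' := circuit_free_le (@vrestr_le _ y X) fy.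
have [z [fz xz sz yz]] := circuit_free_extend fx fy' sx (vsupp_vrestr y X).
exists z; split=> //; apply/eqP; rewrite eqn_leq rho_ub //=.
by rewrite -yX -vsum_vrestr !vsum_supp // vsupp_vrestr.
Qed.

(** For submodularity, a maximiser for the intersection is extended to one for the union; the latter
    attains at least both ranks, while its sums over [A] and [B] bound the other side. *)
Lemma rank_is_polymatroid : is_polymatroid rho.
Proof.
split=> [|A B AB|A B].
- by have [w _ <-] := rho_attained finset.set0; rewrite /vsum big_set0.
- have [w fw <-] := rho_attained A.
  by apply: leq_trans (vsum_subset w AB) (rho_ub _ fw).
have s0 : vsupp [ffun=> 0] \subset A :&: B.
  by apply/fintype.subsetP=> i; rewrite inE ffunE.
have [x [fx _ sx xI]] := rank_attained_above circuit_free0 s0.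
have IU : A :&: B \subset A :|: B by rewrite finset.subIset // finset.subsetUl.
have [z [fz xz _ zU]] := rank_attained_above fx (fintype.subset_trans sx IU).
have := vsum_le (A :&: B) xz; have := vsum_setUI z A B.
by have := rho_ub A fz; have := rho_ub B fz; lia.
Qed.

(** By (C1) the vector m_i e_i is circuit-free. *)
Lemma rank_set1 i : rho [set i]%SET = m i.
Proof.
apply/eqP; rewrite eqn_leq; apply/andP; split.
  by have [w [bw _] <-] := rho_attained [set i]%SET; rewrite /vsum big_set1.
pose w : vec n := [ffun h => if h == i then m i else 0].
have fw : circuit_free w.
  split=> [h|u Cu uw]; first by rewrite ffunE; case: eqP => [->|].
  have [c1 _ _ _] := C_axioms; have := c1 _ Cu; rewrite ltnNge; apply/negP.
  rewrite negbK -[leqRHS](cards1 i); apply/subset_leq_card/fintype.subsetP=> h; rewrite !inE.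
  by have := uw h; rewrite ffunE; case: (eqVneq h i) => // _; lia.
by have := rho_ub [set i]%SET fw; rewrite /vsum big_set1 ffunE eqxx.
Qed.

(* A circuit-free vector on the support of u of size at least |u| above u - e_j
   would exceed u at some i != j, hence dominate the circuit given by (C4). *)
Lemma rank_lt_circuit u : C u -> rho (vsupp u) < vsize u.
Proof.
move=> Cu; rewrite ltnNge; apply/negP=> le.
have [c1 _ _ c4] := C_axioms.
have [j uj] : exists j, 0 < u j.
  have /card_gt0P[j] : 0 < #|[set i | 0 < u i]%SET| by apply: ltnW (c1 _ Cu).
  by rewrite inE; exists j.
have fu := circuit_free_vlt Cu (vlt_vdec uj).
have su : vsupp (vdec u j) \subset vsupp u.
  by apply/fintype.subsetP=> h; rewrite !inE ffunE; lia.
have [z [fz uz sz zu]] := rank_attained_above fu su.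
have [bz nz] := fz.
have zj : z j < u j.
  rewrite ltnNge; apply/negP=> ujz; apply: (nz u Cu) => h.
  by have := uz h; rewrite ffunE; case: eqP => [->|]; lia.
have [i iu ui] : exists2 i, i != j & u i < z i.
  apply: contrapT => H; suff : vlt z u.
    by move/vsize_lt; rewrite -(vsum_supp sz) zu; lia.
  split=> [h|zu']; last by move: zj; rewrite zu'; lia.
  have [->|hj] := eqVneq h j; first by lia.
  by rewrite leqNgt; apply/negP=> uh; apply: H; exists h.
have [||||v [Cv vi vle vj]] := c4 u i j Cu.
- by have /fintype.subsetP/(_ i) := sz; rewrite !inE; apply; lia.
- by have := bz i; lia.
- by move=> ji; rewrite ji eqxx in iu.
- by [].
apply: (nz v Cv) => h.
have [->|hi] := eqVneq h i; first by rewrite vi addn1.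
have := vle h (elimN eqP hi); have := uz h; rewrite ffunE.
by case: eqP => [->|]; lia.
Qed.

(** Members of [C] are dependent and vectors strictly below them are not. Conversely a circuit of
    [rho] dominates a member of [C], or it would be circuit-free and so independent; minimality
    makes them equal. *)
Lemma circuits_rank : circuits rho = C.
Proof.
have dC u : C u -> ~ independent rho u.
  move=> Cu /(_ (vsupp u)); rewrite vsum_supp //.
  by have := rank_lt_circuit Cu; lia.
apply/seteqP; split=> [u [bu du mu]|u Cu].
  have [[c Cc cu]|nc] := pselect (exists2 c, C c & vle c u).
    have [<-//|ne] := pselect (c = u).
    by case: (dC c Cc); apply: mu.
  case: du => X; apply: rho_ub; split=> [i|c Cc cu]; first by rewrite -rank_set1.
  by apply: nc; exists c.
split=> [i||w wu X]; [by rewrite rank_set1; apply: C_box|exact: dC|].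
by apply: rho_ub; apply: circuit_free_vlt wu.
Qed.

End Rank.

(** The maxima exist because sums over [X] are bounded by the sum of [m] over [X]. *)
Lemma rank_exists : exists rho : {ffun {set 'I_n} -> nat},
  (forall X, exists2 w, circuit_free w & vsum w X = rho X) /\
  (forall w X, circuit_free w -> vsum w X <= rho X).
Proof.
have ex X : exists k, (exists2 w, circuit_free w & vsum w X = k) /\
    (forall w, circuit_free w -> vsum w X <= k).
  pose P k := `[< exists2 w, circuit_free w & vsum w X = k >].
  have exP : exists k, P k.
    by exists (vsum [ffun=> 0] X); apply/asboolP; exists [ffun=> 0]; first exact: circuit_free0.
  have ubP k : P k -> k <= \sum_(i in X) m i.
    by move=> /asboolP[w [bw _] <-]; apply: leq_sum.
  have [k /asboolP Pk maxk] := ex_maxnP exP ubP.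
  by exists k; split=> // w fw; apply: maxk; apply/asboolP; exists w.
have [f fP] := choice ex.
exists [ffun X => f X]; split=> [X|w X fw]; rewrite ffunE; first exact: (fP X).1.
exact: (fP X).2.
Qed.

End PolymatroidOfCircuits.

(** * The equivalence and the uniqueness assembled *)

Theorem theorem4p3 (n : nat) (n_gt0 : 0 < n) (m : 'I_n -> nat)
    (C : set (vec n)) (C_box : (C `<=` box m)%classic)
    (C_max : forall i : 'I_n, (exists u : vec n, C u /\ 0 < u i) ->
       is_max [set u i | u in C]%classic (m i)) :
  ((exists rho : {ffun {set 'I_n} -> nat},
      is_polymatroid rho /\ circuits rho = C)
   <-> circuit_axioms m C)
  /\ (circuit_axioms m C ->
      exists! rho : {ffun {set 'I_n} -> nat},
        [/\ is_polymatroid rho,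
            (forall i : 'I_n, rho [set i]%SET = m i) &
            circuits rho = C]).
Proof.
have exC : circuit_axioms m C -> exists rho : {ffun {set 'I_n} -> nat},
    [/\ is_polymatroid rho, forall i, rho [set i]%SET = m i & circuits rho = C].
  move=> axC; have [rho [att ub]] := rank_exists axC.
  exists rho; split.
  - exact: rank_is_polymatroid axC _ att ub.
  - exact: rank_set1 axC _ att ub.
  - exact: circuits_rank C_box axC _ att ub.
split; [split|].
- move=> [rho [pr eC]]; rewrite -eC in C_max *; split.
  + exact: circuits_C1.
  + exact: circuits_C2.
  + exact: circuits_C3.
  + move=> u i j cu ui um; apply: (circuits_C4 pr) => //.
    (* The cap in (C4) for [rho] is its value on {i}; since m_i is the [i]-entry of some circuit,
       m_i is at most that value. *)
    have [|[v [bv _ _] vm] _] := C_max i; first by exists u.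
    by rewrite -vm in um; apply: leq_trans um (bv i).
- by move=> /exC[rho [pr _ eC]]; exists rho.
- move=> /exC[rho [pr r1 eC]]; exists rho; split=> // rho' [pr' r1' eC'].
  apply: polymatroid_circuits_inj => //; last by rewrite eC eC'.
  by move=> i; rewrite r1 r1'.
Qed.
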